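(* Let $k\ge 3$ be an integer and $\lambda\ge 1$ a real number, and let $t(m)=\sqrt{m/2+1/16}-1/4$. There is a constant $C=C(k,\lambda)$ such that every graph $G$ with $m\ge 1$ edges has a partition $V(G)=V_1\cup\cdots\cup V_k$ with $$\sum_{i=1}^k e(V_i)^\lambda\le \frac{1}{k^{2\lambda-1}}m^\lambda-\frac{(k-1)\lambda}{k^{2\lambda-1}}m^{\lambda-1}t(m)+C\,m^{\lambda-1}.$$
   Context: $e(V_i)$ denotes the number of edges of $G$ with both ends in $V_i$. *)

(* Defs.v *)
From mathcomp Require Import all_boot.
From Stdlib Require Import Reals.

Set Implicit Arguments.
Unset Strict Implicit.
Unset Printing Implicit Defensive.

Definition simple_graph (T : finType) (adj : rel T) : Prop :=
  symmetric adj /\ irreflexive adj.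

Definition edges_in (T : finType) (adj : rel T) (S : {set T}) : nat :=
  #|[set A : {set T} | [exists x, exists y,
      [&& A == [set x; y], adj x y, x \in S & y \in S]]]|.

Definition nedges (T : finType) (adj : rel T) : nat := edges_in adj setT.

(* real power x^y for x >= 0 (with 0^y = 0); Rpower is exp (y ln x) *)
Definition powR (x y : R) : R :=
  if Rlt_dec 0 x then Rpower x y else 0%R.

Definition tfun (m : R) : R := (sqrt (m / 2 + 1 / 16) - 1 / 4)%R.

(* Main.v *)
(* Put a = m / k^2.  Since x^lam <= a^lam + lam a^(lam-1) ((x - a) + O((x - a)^2 / m)) on
   [0, m], it suffices to find a partition in which either
     sum (e_i - a) + (beta / m) sum (e_i - a)^2 <= - (k-1)/k t(m) + O(1),
   or every e_i is below a - lam t(m).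

   Averaging over balanced mergings of a proper colouring with about sqrt(2m) colours
   gives sum e_i <= m/k - (k-1)/k t(m) + O(1), hence so does a maximum k-cut.  At a
   maximum cut e(V_i, V_j) >= 2 max(e_i, e_j), so that the surplus s = m/k - sum e_i
   dominates all the deviations |e_i - a|, and the first alternative holds as long as
   s <= eps m.

   If s > eps m, colour the vertices at random so that every e_i has expectation at most
   a - c m.  When all degrees are below delta m, perturb the uniform distribution along
   the indicator of a part of the maximum cut, projected orthogonally to the degrees.
   Otherwise put the vertices of high degree into one part and bias the remaining ones
   away from it.  Randomising only vertices of degree at most delta m keeps the variance
   of e_i at O(delta m^2). *)
Require Import Defs.
From Stdlib Require Import Reals Lra.

(** * Real powers *)

Local Open Scope R_scope.

Lemma Rpower_bernoulli (v lam : R) : 0 < v -> 1 <= lam ->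
  1 + lam * (v - 1) <= Rpower v lam.
Proof.
intros v0 l1.
(* tangent line of [exp] at [ln v], evaluated at [lam * ln v] and at [0] *)
assert (E : exp (ln v) = v) by now apply exp_ln.
unfold Rpower; set (y := ln v) in *.
assert (H1 : v * (1 + (lam - 1) * y) <= exp (lam * y)).
{ replace (lam * y) with (y + (lam - 1) * y) by ring.
  rewrite exp_plus, E; apply Rmult_le_compat_l; [lra | apply exp_ineq1_le]. }
assert (H2 : v * (1 - y) <= 1).
{ assert (F : v * exp (- y) = 1)
    by (rewrite <- E, <- exp_plus, Rplus_opp_r; apply exp_0).
  rewrite <- F; apply Rmult_le_compat_l; [lra |].
  rewrite F; assert (H := exp_ineq1_le (- y)); lra. }
nra.
Qed.

Lemma Rpower_pred (u lam : R) : 0 < u -> Rpower u lam = Rpower u (lam - 1) * u.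
Proof.
intros u0; rewrite <- (Rpower_1 u) at 3 by assumption.
rewrite <- Rpower_plus; f_equal; ring.
Qed.

(** Bernoulli's inequality at [/ u], multiplied by [Rpower u lam]: the tangent to the power at [u],
    evaluated at 1, stays below the value 1. *)
Lemma Rpower_tangent (u lam : R) : 0 < u -> 1 <= lam ->
  Rpower u lam - 1 <= lam * Rpower u (lam - 1) * (u - 1).
Proof.
intros u0 l1.
assert (iu : 0 < / u) by now apply Rinv_0_lt_compat.
assert (H := Rpower_bernoulli (/ u) lam iu l1).
assert (E : Rpower u lam * Rpower (/ u) lam = 1).
{ rewrite Rpower_mult_distr by assumption.
  rewrite Rinv_r by lra. unfold Rpower; rewrite ln_1, Rmult_0_r; apply exp_0. }
assert (E2 := Rpower_pred u lam u0).
assert (P : 0 < Rpower u (lam - 1)) by apply exp_pos.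
assert (H' : Rpower u lam * (1 + lam * (/ u - 1)) <= 1).
{ apply Rle_trans with (Rpower u lam * Rpower (/ u) lam); [| now right].
  apply Rmult_le_compat_l; [left; apply exp_pos | exact H]. }
rewrite E2 in H' |- *.
replace (Rpower u (lam - 1) * u * (1 + lam * (/ u - 1)))
  with (Rpower u (lam - 1) * (u + lam * (1 - u))) in H' by (field; lra).
lra.
Qed.

Lemma powR_pos (x y : R) : 0 < x -> powR x y = Rpower x y.
Proof. now intros x0; unfold powR; destruct (Rlt_dec 0 x). Qed.

Lemma powR_0 (y : R) : powR 0 y = 0.
Proof. unfold powR; destruct (Rlt_dec 0 0); simpl; [lra | reflexivity]. Qed.

Lemma powR_ge0 (x y : R) : 0 <= powR x y.
Proof.
unfold powR; destruct (Rlt_dec 0 x); simpl; [left; apply exp_pos | lra].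
Qed.

(** The tangent at [u] bounds the excess over the tangent at 1 by lam (u^(lam-1) - 1) (u - 1). As
    lam - 1 may be below 1, the first difference is compared with u^lam - 1, which [Rpower_tangent]
    controls for u >= 1 and [Rpower_bernoulli] for u < 1. *)
Lemma powR_quadratic (lam B : R) : 1 <= lam -> 1 <= B ->
  exists beta, 0 <= beta /\ forall u, 0 <= u <= B ->
    powR u lam <= 1 + lam * (u - 1) + beta * (u - 1) ^ 2.
Proof.
intros l1 B1.
set (beta := lam * (lam * Rpower B (lam - 1))).
assert (PB : 1 <= Rpower B (lam - 1)).
{ apply Rle_trans with (Rpower B 0); [right; symmetry; apply Rpower_O; lra |].
  apply Rle_Rpower; lra. }
assert (HB : lam * 1 <= lam * Rpower B (lam - 1)) by (apply Rmult_le_compat_l; lra).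
assert (b1 : lam * lam <= beta) by (apply Rmult_le_compat_l; lra).
assert (b2 : lam * 1 <= lam * lam) by (apply Rmult_le_compat_l; lra).
assert (b0 : 0 <= beta) by lra.
exists beta; split; [exact b0 | intros u [u0 uB]].
destruct u0 as [up | <-];
  [| rewrite powR_0; replace ((0 - 1) ^ 2) with 1 by ring; lra].
rewrite powR_pos by assumption.
assert (H := Rpower_tangent u lam up l1).
enough (lam * ((Rpower u (lam - 1) - 1) * (u - 1)) <= beta * (u - 1) ^ 2) by lra.
assert (E2 := Rpower_pred u lam up).
assert (P : 0 < Rpower u (lam - 1)) by apply exp_pos.
unfold beta; rewrite Rmult_assoc; apply Rmult_le_compat_l; [lra |].
destruct (Rle_dec 1 u) as [u1 | u1].
- assert (Rpower u (lam - 1) <= Rpower B (lam - 1)) by (apply Rle_Rpower_l; lra).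
  assert (Rpower u (lam - 1) - 1 <= lam * Rpower B (lam - 1) * (u - 1)); [| nra].
  apply Rle_trans with (lam * Rpower u (lam - 1) * (u - 1)); [nra |].
  apply Rmult_le_compat_r; [lra |]. apply Rmult_le_compat_l; lra.
- assert (HB' := Rpower_bernoulli u lam up l1).
  assert (1 - Rpower u (lam - 1) <= lam * Rpower B (lam - 1) * (1 - u)); [| nra].
  apply Rle_trans with (lam * (1 - u)); [nra |].
  apply Rmult_le_compat_r; lra.
Qed.

Lemma powR_scale (lam a u : R) : 0 < a -> 0 <= u ->
  powR (a * u) lam = powR a (lam - 1) * (a * powR u lam).
Proof.
intros a0 [u0 | <-].
- rewrite !powR_pos by (try apply Rmult_lt_0_compat; assumption).
  rewrite <- Rpower_mult_distr by assumption.
  rewrite <- Rmult_assoc; f_equal.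
  now apply Rpower_pred.
- rewrite Rmult_0_r, !powR_0; ring.
Qed.

(** [powR_quadratic] at x / a, which is at most k^2 because m = a k^2. *)
Lemma powR_taylor (lam k : R) : 1 <= lam -> 1 <= k ->
  exists beta, 0 <= beta /\ forall m x, 0 < m -> 0 <= x <= m ->
    let a := m / k ^ 2 in
    powR x lam <= powR a (lam - 1) * (a + lam * (x - a) + beta / m * (x - a) ^ 2).
Proof.
intros l1 k1.
assert (K1 : 1 <= k ^ 2) by nra.
destruct (powR_quadratic lam (k ^ 2) l1 K1) as [beta [b0 Hb]].
exists (beta * k ^ 2); split; [nra |].
intros m x m0 [x0 xm] a.
assert (a0 : 0 < a) by (apply Rdiv_lt_0_compat; lra).
assert (ma : m = a * k ^ 2) by (unfold a; field; lra).
assert (xa : x = a * (x / a)) by (field; lra).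
assert (u0 : 0 <= x / a) by (apply Rle_mult_inv_pos; lra).
assert (uB : x / a <= k ^ 2).
{ apply Rmult_le_reg_l with a; [exact a0 |]. rewrite <- xa; lra. }
rewrite xa at 1; rewrite powR_scale by assumption.
apply Rmult_le_compat_l.
{ apply powR_ge0. }
apply Rle_trans with (a * (1 + lam * (x / a - 1) + beta * (x / a - 1) ^ 2)).
{ apply Rmult_le_compat_l; [lra | apply Hb; lra]. }
right; rewrite ma; field; split; lra.
Qed.

(** (x / a)^lam <= x / a on [0, a]. This serves partitions with all parts well below a, where the
    squared deviations are not controlled. *)
Lemma powR_below (lam a x : R) : 1 <= lam -> 0 < a -> 0 <= x <= a ->
  powR x lam <= powR a (lam - 1) * x.
Proof.
intros l1 a0 [x0 xa].
assert (E : x = a * (x / a)) by (field; lra).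
assert (u0 : 0 <= x / a) by (apply Rle_mult_inv_pos; lra).
assert (u1 : x / a <= 1).
{ apply Rmult_le_reg_l with a; [exact a0 |]. rewrite <- E; lra. }
rewrite E at 1; rewrite powR_scale by assumption.
apply Rmult_le_compat_l.
{ apply powR_ge0. }
rewrite E at 2; apply Rmult_le_compat_l; [lra |].
destruct u0 as [up | <-]; [| rewrite powR_0; lra].
rewrite powR_pos by assumption.
assert (0 < Rpower (x / a) (lam - 1) <= 1).
{ split; [apply exp_pos |].
  apply Rle_trans with (exp 0); [unfold Rpower | right; apply exp_0].
  assert (ln (x / a) <= 0) by (destruct u1 as [h | ->];
    [left; rewrite <- ln_1; now apply ln_increasing | rewrite ln_1; lra]).
  destruct (Rle_lt_or_eq_dec ((lam - 1) * ln (x / a)) 0) as [h | h]; [nra | |].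
  - left; now apply exp_increasing.
  - right; now rewrite h. }
replace lam with ((lam - 1) + 1) by ring.
rewrite Rpower_plus, Rpower_1 by assumption; nra.
Qed.

(** With a = m / k^2, the factor m^(lam-1) equals a^(lam-1) k^(2 lam - 2); hence the division of
    [C]. *)
Lemma powR_normalise (lam k m t C : R) : 0 < k -> 0 < m ->
  powR m lam / powR k (2 * lam - 1)
    - (k - 1) * lam / powR k (2 * lam - 1) * powR m (lam - 1) * t
    + C / powR k (2 * lam - 2) * powR m (lam - 1)
  = powR (m / k ^ 2) (lam - 1) * (m / k - (k - 1) * lam / k * t + C).
Proof.
intros k0 m0.
assert (k20 : 0 < k ^ 2) by nra.
assert (a0 : 0 < m / k ^ 2) by (apply Rdiv_lt_0_compat; lra).
rewrite !powR_pos by assumption.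
set (a := m / k ^ 2) in *.
assert (ma : m = a * k ^ 2) by (unfold a; field; lra).
assert (E : Rpower m (lam - 1) = Rpower a (lam - 1) * Rpower k (2 * lam - 2)).
{ rewrite ma at 1; rewrite <- Rpower_mult_distr by assumption; f_equal.
  rewrite <- Rpower_pow by assumption; rewrite Rpower_mult; f_equal.
  simpl; ring. }
assert (E1 : Rpower m lam = Rpower m (lam - 1) * m).
{ now apply Rpower_pred. }
assert (E2 : Rpower k (2 * lam - 1) = Rpower k (2 * lam - 2) * k).
{ rewrite (Rpower_pred k) by assumption; do 2 f_equal; ring. }
assert (P : 0 < Rpower k (2 * lam - 2)) by apply exp_pos.
rewrite E1, E2, E; field; split; lra.
Qed.

Lemma tfun_ge0 (m : R) : 0 <= m -> 0 <= tfun m.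
Proof.
intros m0; unfold tfun.
assert (1 / 4 <= sqrt (m / 2 + 1 / 16)); [| lra].
rewrite <- (sqrt_square (1 / 4)) by lra.
apply sqrt_le_1; lra.
Qed.

(** With n = 2 [tfun m] + 1 this reads m = n (n - 1) / 2: n is the order of a complete graph with m
    edges, extended to real values. *)
Lemma tfun_eq (m : R) : 0 <= m -> m = tfun m * (2 * tfun m + 1).
Proof.
intros m0; unfold tfun.
assert (H := sqrt_sqrt (m / 2 + 1 / 16)).
assert (0 <= m / 2 + 1 / 16) by lra.
nra.
Qed.

Local Close Scope R_scope.

From mathcomp Require Import all_boot all_order all_algebra all_fingroup.
From mathcomp Require Import ring lra zify Rstruct.
Set Implicit Arguments. Unset Strict Implicit. Unset Printing Implicit Defensive.
Import Order.TTheory GRing.Theory Num.Theory.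
Local Open Scope ring_scope.

(** * Bilinear forms and rounding of fractional colourings *)

Lemma weighted_mean_attained (R : realFieldType) (I : finType) (p F : I -> R) (B : R) :
  (forall i, 0 <= p i) -> \sum_i p i = 1 -> \sum_i p i * F i <= B ->
  exists i, F i <= B.
Proof.
move=> p0 p1 hB; apply/existsP; apply: contraT.
rewrite negb_exists => /forallP h.
have hF i : B < F i by rewrite ltNge; exact: h.
have : \sum_i p i * F i > B.
  rewrite -[ltLHS]mul1r -p1 mulr_suml.
  have [i pi] : exists i, 0 < p i.
    apply/existsP; apply: contraT; rewrite negb_exists => /forallP hp.
    have : \sum_i p i = 0.
      by apply: big1 => i _; apply/eqP; rewrite eq_le p0 andbT leNgt hp.
    by rewrite p1 => /eqP; rewrite oner_eq0.
  rewrite (bigD1 i) //= [ltRHS](bigD1 i) //= ltr_leD //.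
    by rewrite ltr_pM2l.
  by apply: ler_sum => j _; rewrite ler_wpM2l // ltW.
by move=> /lt_le_trans /(_ hB); rewrite ltxx.
Qed.

Definition bilin (R : realFieldType) (T : finType) (w : T -> T -> R) (u v : T -> R) : R :=
  \sum_x \sum_y w x y * (u x * v y).

Definition deg (R : realFieldType) (T : finType) (w : T -> T -> R) (x : T) : R :=
  \sum_y w x y.

Section Form.
Variables (R : realFieldType) (T : finType) (w : T -> T -> R).
Hypothesis wC : forall x y, w x y = w y x.

Lemma eq_bilin u u' v v' : u =1 u' -> v =1 v' -> bilin w u v = bilin w u' v'.
Proof.
by move=> hu hv; apply: eq_bigr => x _; apply: eq_bigr => y _; rewrite hu hv.
Qed.

Lemma bilinC u v : bilin w u v = bilin w v u.
Proof.
rewrite /bilin exchange_big; apply: eq_bigr => x _; apply: eq_bigr => y _.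
by rewrite wC [u y * _]mulrC.
Qed.

Lemma bilinDr u v v' : bilin w u (fun x => v x + v' x) = bilin w u v + bilin w u v'.
Proof.
rewrite -big_split; apply: eq_bigr => x _; rewrite -big_split.
by apply: eq_bigr => y _ /=; rewrite !mulrDr.
Qed.

Lemma bilinZr a u v : bilin w u (fun x => a * v x) = a * bilin w u v.
Proof.
rewrite mulr_sumr; apply: eq_bigr => x _; rewrite mulr_sumr.
by apply: eq_bigr => y _; ring.
Qed.

Lemma bilin_sumr (I : finType) u (v : I -> T -> R) :
  bilin w u (fun x => \sum_i v i x) = \sum_i bilin w u (v i).
Proof.
rewrite /bilin; under eq_bigr => x _.
  under eq_bigr => y _ do rewrite !mulr_sumr.
  rewrite exchange_big; over.
by rewrite exchange_big.
Qed.

Lemma bilin_comb a b u v :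
  bilin w (fun x => a * u x + b * v x) (fun x => a * u x + b * v x) =
  a ^+ 2 * bilin w u u + 2 * a * b * bilin w u v + b ^+ 2 * bilin w v v.
Proof.
rewrite bilinDr !bilinZr ![bilin w (fun _ => _ + _) _]bilinC !bilinDr !bilinZr.
by rewrite (bilinC v u); ring.
Qed.

Lemma bilin_delta x v : bilin w (fun y => (y == x)%:R) v = \sum_y w x y * v y.
Proof.
rewrite /bilin (bigD1 x) //= [X in _ + X]big1 ?addr0 => [|y /negPf ->].
  by apply: eq_bigr => y _; rewrite eqxx mul1r.
by apply: big1 => z _; rewrite mul0r mulr0.
Qed.

Lemma bilin1 v : bilin w (fun=> 1) v = \sum_x deg w x * v x.
Proof.
rewrite bilinC /bilin; apply: eq_bigr => x _; rewrite /deg mulr_suml.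
by apply: eq_bigr => y _; rewrite mulr1.
Qed.

Lemma bilin11 : bilin w (fun=> 1) (fun=> 1) = \sum_x deg w x.
Proof. by rewrite bilin1; apply: eq_bigr => x _; rewrite mulr1. Qed.

Hypothesis w0 : forall x y, 0 <= w x y.

Lemma deg_ge0 x : 0 <= deg w x.
Proof. exact: sumr_ge0. Qed.

Lemma bilin_ge0 u v : (forall x, 0 <= u x) -> (forall x, 0 <= v x) -> 0 <= bilin w u v.
Proof.
by move=> hu hv; apply: sumr_ge0 => x _; apply: sumr_ge0 => y _; rewrite !mulr_ge0.
Qed.

End Form.

Section Rounding.
Variables (R : realFieldType) (T I : finType) (w : T -> T -> R).
Hypothesis wC : forall x y, w x y = w y x.
Hypothesis w0 : forall x y, 0 <= w x y.
Hypothesis wxx : forall x, w x x = 0.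

(** The row [f x] is read as the law of the colour of [x], independently over the vertices. As [w]
    vanishes on the diagonal, [inside f i] below is then the expected doubled weight inside the part
    [i]. *)
Definition stochastic (f : T -> I -> R) :=
  (forall x i, 0 <= f x i) /\ (forall x, \sum_i f x i = 1).

(* For an integral [f], [inside f i] counts every edge of the part [i] twice. *)
Definition inside (f : T -> I -> R) (i : I) : R := bilin w (f^~ i) (f^~ i).

Definition dirac (c : T -> I) (x : T) (i : I) : R := (c x == i)%:R.

(** The law conditioned on the colour [c] at [x]. *)
Definition fix_at (f : T -> I -> R) (x : T) (c : I) (y : T) (i : I) : R :=
  if y == x then (c == i)%:R else f y i.

Lemma sum_delta (c : I) (F : I -> R) : \sum_i (c == i)%:R * F i = F c.
Proof.
rewrite (bigD1 c) //= eqxx mul1r big1 ?addr0 // => i ic.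
by rewrite eq_sym (negPf ic) mul0r.
Qed.

Lemma sum_delta1 (c : I) : \sum_i (c == i)%:R = 1 :> R.
Proof.
by rewrite -[RHS](sum_delta c (fun=> 1)); apply: eq_bigr => i _; rewrite mulr1.
Qed.

Lemma stochastic_fix_at f x c : stochastic f -> stochastic (fix_at f x c).
Proof.
move=> [f0 f1]; split=> y; first by move=> i; rewrite /fix_at; case: ifP; rewrite ?ler0n.
by rewrite /fix_at; case: (y == x); rewrite ?sum_delta1.
Qed.

Lemma inside_fix_at f x c i :
  inside (fix_at f x c) i =
  inside f i + 2 * ((c == i)%:R - f x i) * \sum_y w x y * f y i.
Proof.
rewrite /inside; set b := _ - f x i.
have E : (fix_at f x c)^~ i =1 (fun y => 1 * f y i + b * (y == x)%:R).
  move=> y; rewrite /fix_at mul1r /b; case: eqP => [->|_].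
    by rewrite mulr1 addrC subrK.
  by rewrite mulr0 addr0.
rewrite (eq_bilin w E E) bilin_comb // bilin_delta.
rewrite [\sum_y _ * (y == x)%:R](bigD1 x) //= wxx mul0r add0r.
rewrite [\sum_(y | y != x) _]big1 => [|y /negPf ->]; last by rewrite mulr0.
by rewrite [bilin w _ (fun y => (y == x)%:R)]bilinC // bilin_delta; ring.
Qed.

(** Draw [c] from [f x]. The change of [inside f i] has mean zero, so the expected squared deviation
    grows by its variance 4 h_i^2 f_i (1 - f_i), at most 4 deg^2 f_i; the f_i sum to 1. Some [c]
    does no worse than the mean. *)
Lemma round_one f x (mu : I -> R) : stochastic f ->
  exists c, \sum_i (inside (fix_at f x c) i - mu i) ^+ 2 <=
            \sum_i (inside f i - mu i) ^+ 2 + 4 * deg w x ^+ 2.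
Proof.
move=> [f0 f1].
apply: (weighted_mean_attained (f0 x) (f1 x)).
under eq_bigr => c _ do rewrite mulr_sumr.
rewrite exchange_big /=.
set h := fun i => \sum_y w x y * f y i.
have h0 i : 0 <= h i by apply: sumr_ge0 => y _; rewrite mulr_ge0.
have fle1 y i : f y i <= 1.
  by rewrite -(f1 y) (bigD1 i) //= lerDl sumr_ge0.
have hd i : h i <= deg w x.
  by apply: ler_sum => y _; rewrite ler_piMr.
have -> : 4 * deg w x ^+ 2 = \sum_i f x i * (4 * deg w x ^+ 2).
  by rewrite -mulr_suml f1 mul1r.
rewrite -big_split; apply: ler_sum => i _ /=.
have E c : f x c * (inside (fix_at f x c) i - mu i) ^+ 2 =
   f x c * (inside f i - mu i - 2 * f x i * h i) ^+ 2
   + (c == i)%:R * (f x c *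
      (4 * h i * (inside f i - mu i - 2 * f x i * h i) + 4 * h i ^+ 2)).
  rewrite inside_fix_at -/(h i); case: (c == i) => /=; ring.
under eq_bigr => c _ do rewrite E eq_sym.
rewrite big_split -mulr_suml f1 /= sum_delta.
have : h i ^+ 2 * (f x i * (1 - f x i)) <= deg w x ^+ 2 * f x i.
  apply: ler_pM; rewrite ?sqr_ge0 ?mulr_ge0 ?subr_ge0 ?ler_sqr ?nnegrE ?deg_ge0 //.
  by rewrite ler_piMr // gerBl.
by set A := inside f i - mu i => H; nra.
Qed.

Lemma round_seq (s : seq T) f (mu : I -> R) : stochastic f ->
  exists g, [/\ stochastic g,
    forall x, x \notin s -> g x = f x,
    forall x, x \in s -> exists c, g x = fun i => (c == i)%:R &
    \sum_i (inside g i - mu i) ^+ 2 <=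
    \sum_i (inside f i - mu i) ^+ 2 + \sum_(x <- s) 4 * deg w x ^+ 2].
Proof.
move=> hf; elim: s => [|x s [g [hg gN gs le_g]]].
  by exists f; split=> //; rewrite big_nil addr0.
have [c hc] := round_one x mu hg.
exists (fix_at g x c); split.
- exact: stochastic_fix_at.
- move=> y; rewrite inE negb_or => /andP[yx ys].
  by rewrite /fix_at (negPf yx); exact: gN.
- move=> y; rewrite inE /fix_at; case: (y =P x) => [_ _|_ /= /gs //].
  by exists c.
- rewrite big_cons; apply: le_trans hc _.
  by rewrite addrCA [leLHS]addrC lerD2l.
Qed.

(* Conditional expectations with the squared deviation as potential: rounding the
   vertex [x] raises the expected potential by at most [4 * deg x ^ 2]. *)
Lemma rounding (A : pred T) f (c0 : T -> I) : stochastic f ->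
  (forall x, A x -> forall i, f x i = dirac c0 x i) ->
  exists c : T -> I, \sum_i (inside (dirac c) i - inside f i) ^+ 2 <=
     4 * \sum_(x | ~~ A x) deg w x ^+ 2.
Proof.
move=> hf fA; have [g [hg gN gs le_g]] := round_seq (enum [pred x | ~~ A x]) (inside f) hf.
have gint x : [exists c, [forall i, g x i == (c == i)%:R]].
  apply/existsP; case hA: (A x).
    exists (c0 x); apply/forallP=> i.
    by rewrite gN ?mem_enum ?inE ?hA // fA.
  have [|c gx] := gs x; first by rewrite mem_enum inE hA.
  by exists c; apply/forallP=> i; rewrite gx.
pose c x := xchoose (existsP (gint x)).
have gE x i : g x i = dirac c x i.
  by have /forallP/(_ i)/eqP -> := xchooseP (existsP (gint x)).
have cE i : inside (dirac c) i = inside g i.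
  by apply: eq_bilin => x; rewrite gE.
exists c; under eq_bigr => i _ do rewrite cE.
apply: le_trans le_g _; rewrite big1 ?add0r => [|i _]; last by rewrite subrr expr0n.
by rewrite big_enum /= mulr_sumr.
Qed.
End Rounding.

(** * Maximum cuts *)

Lemma sum_cst (R : realFieldType) (I : finType) (a : R) : \sum_(i : I) a = #|I|%:R * a.
Proof. by rewrite sumr_const mulr_natl. Qed.

Section MaxCut.
Variables (R : realFieldType) (T I : finType) (w : T -> T -> R).
Hypothesis wC : forall x y, w x y = w y x.
Hypothesis w0 : forall x y, 0 <= w x y.
Hypothesis wxx : forall x, w x x = 0.
Notation M := (bilin w (fun=> 1) (fun=> 1)).
Variable k : R.
Hypothesis kI : #|I|%:R = k.
Implicit Type c : T -> I.

Definition between c (i j : I) : R := bilin w ((dirac R c)^~ i) ((dirac R c)^~ j).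

Lemma sum_between c : \sum_i \sum_j between c i j = M.
Proof.
have E (x : T) : \sum_i dirac R c x i = 1 by exact: sum_delta1.
rewrite [RHS](@eq_bilin _ _ w _ (fun x => \sum_i dirac R c x i) _
   (fun x => \sum_i dirac R c x i)) // bilin_sumr exchange_big.
apply: eq_bigr => j _; rewrite bilinC // bilin_sumr.
by apply: eq_bigr => i _; rewrite bilinC.
Qed.

(** Moving one vertex [x] of the part [i] to [j] does not improve an optimal colouring, so [x] has
    at least as much weight towards [j] as towards [i]. Sum over [x] in the part [i]. *)
Lemma inside_le_between c :
  (forall c', \sum_i inside w (dirac R c) i <= \sum_i inside w (dirac R c') i) ->
  forall i j, inside w (dirac R c) i <= between c i j.
Proof.
move=> cmin i j; rewrite /between /inside /bilin; apply: ler_sum => x _.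
have -> F G : \sum_y w x y * (dirac R c x i * F y) <= \sum_y w x y * (dirac R c x i * G y)
   = (dirac R c x i * \sum_y w x y * F y <= dirac R c x i * \sum_y w x y * G y).
  by rewrite !mulr_sumr; congr (_ <= _); apply: eq_bigr => y _; ring.
rewrite /dirac; case: eqP => [cx|_]; last by rewrite !mul0r.
rewrite !mul1r.
have := cmin (fun y => if y == x then j else c y).
rewrite [leRHS](_ : _ = \sum_i inside w (fix_at (dirac R c) x j) i); last first.
  apply: eq_bigr => l _; apply: eq_bilin => y; rewrite /dirac /fix_at;
  by case: (y == x).
under [leRHS]eq_bigr => l _ do rewrite inside_fix_at // -mulrA mulrBl.
rewrite big_split -mulr_sumr sumrB !sum_delta /=.
by rewrite cx lerDl pmulr_rge0 // subr_ge0.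
Qed.

Lemma min_colouring (c0 : T -> I) : exists c : T -> I, forall c',
  \sum_i inside w (dirac R c) i <= \sum_i inside w (dirac R c') i.
Proof.
pose F (c : {ffun T -> I}) := \sum_i inside w (dirac R c) i.
have [c _ cmin] := @Order.TotalTheory.arg_minP _ _ _ [ffun x => c0 x] xpredT F isT.
exists c => c'; have := cmin [ffun x => c' x] isT.
rewrite /F; congr (_ <= _); apply: eq_bigr => i _.
by apply: eq_bilin => x; rewrite /dirac ffunE.
Qed.

(* At a maximum cut [inside i, inside j <= between i j]; summing the maximum over all
   pairs, unequal parts force a surplus. *)
Lemma inside_deviation c : (0 < #|I|)%N ->
  (forall i j, inside w (dirac R c) i <= between c i j) ->
  forall i, `|inside w (dirac R c) i - M / k ^+ 2|
     <= 3 * (M / k - \sum_i inside w (dirac R c) i).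
Proof.
move=> I0 h i0; set q := inside w (dirac R c); set S := \sum_i q i.
have k1 : 1 <= k by rewrite -kI ler1n.
have bC i j : between c i j = between c j i by rewrite /between bilinC.
have kn0 : k != 0 by rewrite gt_eqF //; lra.
pose D := \sum_i \sum_j `|q i - q j|.
(* q_i + q_j + |q_i - q_j| = 2 max(q_i, q_j), which is at most twice [between c i j]. *)
have D2 : 2 * (k * S) + D <= 2 * M.
  have -> : 2 * (k * S) = \sum_i \sum_j (q i + q j).
    under eq_bigr => i _ do rewrite big_split /= sum_cst kI -/S.
    rewrite big_split /= sum_cst kI -mulr_sumr -/S.
    by ring.
  rewrite -big_split -(sum_between c) mulr_sumr; apply: ler_sum => i _ /=.
  rewrite -big_split mulr_sumr; apply: ler_sum => j _ /=.
  have := h i j; have := h j i; rewrite (bC j i) -/(q i) -/(q j).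
  by case: (lerP (q j) (q i)) => ?; lra.
have Di : `|k * q i0 - S| <= D.
  rewrite /D (bigD1 i0) //=; apply: ler_wpDr.
    by apply: sumr_ge0 => i _; apply: sumr_ge0.
  apply: le_trans (ler_norm_sum _ _ _).
  by rewrite sumrB sum_cst kI.
have D0 : 0 <= D by apply: le_trans Di.
have kp : 0 < k by lra.
(* [D] is at most 2 k s, so q_i0 is within 2 s of S / k, while M / k^2 exceeds S / k by s / k <=
   s. *)
set s := M / k - S.
have Ms : M = k * (S + s) by rewrite /s addrC subrK mulrC divfK.
rewrite Ms in D2 *.
have s0 : 0 <= s by rewrite -(pmulr_rge0 _ kp); lra.
have -> : k * (S + s) / k ^+ 2 = S / k + s / k by field.
have sk : s / k <= s by rewrite ler_pdivrMr // ler_peMr.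
have sk0 : 0 <= s / k by rewrite divr_ge0 // ltW.
have : `|q i0 - S / k| <= 2 * s.
  have -> : q i0 - S / k = (k * q i0 - S) / k by field.
  by rewrite normrM normfV [`|k|]gtr0_norm // ler_pdivrMr //; lra.
rewrite !ler_norml; lra.
Qed.

End MaxCut.

(** * Biased random colourings when the surplus is large *)

Lemma balance_poly_other (R : realFieldType) (B : R) : 0 <= B <= 1 ->
  (1 + B / 2 + B ^+ 2 / 4) ^+ 2 * (1 - B) <= 1 - B ^+ 2 / 4.
Proof.
move=> /andP[B0 B1].
(* The series of 1 / sqrt (1 - B) has 3/8 where the factor has 1/4; the difference 1/8, doubled by
   squaring, is the margin B^2 / 4. *)
have -> : (1 + B / 2 + B ^+ 2 / 4) ^+ 2 * (1 - B) = 1 - B ^+ 2 / 4 -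
  (B ^+ 3 / 2 + 3 * B ^+ 4 / 16 + B ^+ 5 / 16) by field.
by rewrite gerBl !addr_ge0 ?divr_ge0 ?mulr_ge0 ?exprn_ge0.
Qed.

(** The terms linear in B cancel. As c >= 1/2, the term c^2 B^2 / 4 is at least B^2 / 16 and c^2 B^3
    / 2 absorbs c B^3 / 4. *)
Lemma balance_poly_heavy (R : realFieldType) (B c X : R) : 0 <= B <= 1 -> 1 / 2 <= c <= 1 ->
  X = 1 - c * (1 + B / 2 + B ^+ 2 / 4) ->
  X ^+ 2 * (1 - B) + X * B <= (1 - c) ^+ 2 - B ^+ 2 / 16.
Proof.
move=> /andP[B0 B1] /andP[c2 c1] XE.
have -> : X ^+ 2 * (1 - B) + X * B = (1 - c) ^+ 2 + c * (B ^+ 3 / 4) -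
  c ^+ 2 * (B ^+ 2 / 4 + B ^+ 3 / 2 + 3 * B ^+ 4 / 16 + B ^+ 5 / 16).
  by rewrite XE; field.
have B2 : 0 <= B ^+ 2 by rewrite exprn_ge0.
have B3 : 0 <= B ^+ 3 by rewrite exprn_ge0.
have B4 : 0 <= B ^+ 4 by rewrite exprn_ge0.
have B5 : 0 <= B ^+ 5 by rewrite exprn_ge0.
have h1 : c / 2 <= c ^+ 2 by rewrite expr2; nra.
have h2 : 1 / 4 <= c ^+ 2 by rewrite expr2; nra.
have := ler_wpM2r B3 h1.
have := ler_wpM2r B2 h2.
have := mulr_ge0 (sqr_ge0 c) B4.
have := mulr_ge0 (sqr_ge0 c) B5.
lra.
Qed.

(* [1 + B / 2 + B ^ 2 / 4] is close to [1 / sqrt (1 - B)], the factor by which the parts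
   not containing the heavy vertices may be enlarged when these cover the proportion [B]
   of the edges; the gain for the heavy part comes from [Y + 1 / Y > 2]. *)
Lemma balanced_bias (R : realFieldType) (k B gamma : R) : 2 <= k -> 0 <= B <= 1 ->
  gamma <= B ^+ 2 / 16 / k ^+ 2 ->
  exists X, [/\ 0 <= X, X <= 1,
   X ^+ 2 * (1 - B) + X * B <= 1 / k ^+ 2 - gamma &
   ((1 - X) / (k - 1)) ^+ 2 * (1 - B) <= 1 / k ^+ 2 - gamma].
Proof.
move=> k2 B01 gB.
have kp : 0 < k by lra.
have kn0 : k != 0 by rewrite gt_eqF.
have k1n0 : k - 1 != 0 by rewrite gt_eqF //; lra.
pose Y := 1 + B / 2 + B ^+ 2 / 4.
(* The share of the light vertices that an unbiased colouring leaves outside the heavy part. *)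
pose cc := (k - 1) / k.
have ccE : 1 - cc = 1 / k by rewrite /cc; field.
have cc2 : 1 / 2 <= cc <= 1.
  rewrite /cc ler_pdivlMr ?ler_pdivrMr; lra.
have Y1 : 1 <= Y by rewrite /Y; have := sqr_ge0 B; lra.
have hother Z : 0 <= Z <= Y -> (Z / k) ^+ 2 * (1 - B) <= 1 / k ^+ 2 - gamma.
  move=> /andP[Z0 ZY].
  have := balance_poly_other B01; rewrite -/Y => hb.
  have hZ : Z ^+ 2 * (1 - B) <= 1 - B ^+ 2 / 16.
    apply: (@le_trans _ _ (1 - B ^+ 2 / 4)); last by have := sqr_ge0 B; lra.
    apply: le_trans hb; rewrite ler_wpM2r ?ler_sqr ?nnegrE ?subr_ge0 //; last lra.
    by move/andP: B01 => [].
  rewrite exprMn exprVn mulrAC ler_pdivrMr ?exprn_gt0 //.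
  apply: (le_trans hZ); rewrite mulrBl divfK ?expf_neq0 // lerB //.
  by rewrite -ler_pdivlMr ?exprn_gt0.
have [cY|cY] := lerP (cc * Y) 1.
  exists (1 - cc * Y); split; [lra| | |].
  - by rewrite gerBl mulr_ge0; lra.
  - apply: le_trans (balance_poly_heavy B01 cc2 erefl) _.
    rewrite ccE expr_div_n expr1n lerB //; apply: (le_trans gB).
    rewrite ler_piMr ?divr_ge0 ?sqr_ge0 // invf_le1 ?exprn_gt0 ?exprn_ege1 //; lra.
  - have -> : (1 - (1 - cc * Y)) / (k - 1) = Y / k by rewrite /cc; field; rewrite kn0.
    by apply: hother; lra.
(* An enlargement by [Y] would exceed the available vertices: the heavy part receives no light
   vertex, and the others grow only by 1 / cc < Y. *)
exists 0; split; [lra|lra| |].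
- rewrite expr0n mul0r mul0r addr0 subr_ge0; apply: (le_trans gB).
  rewrite ler_wpM2r ?invr_ge0 ?sqr_ge0 // ler_pdivrMr //.
  have : B ^+ 2 <= 1 by apply: exprn_ile1; move/andP: B01 => [].
  by lra.
- have -> : (1 - 0) / (k - 1) = (1 / cc) / k by rewrite /cc; field; rewrite kn0 k1n0.
  by apply: hother; rewrite divr_ge0 ?ler_pdivrMr /=; lra.
Qed.

Section Surplus.
Variables (R : realFieldType) (T I : finType) (w : T -> T -> R).
Hypothesis wC : forall x y, w x y = w y x.
Hypothesis w0 : forall x y, 0 <= w x y.
Hypothesis wxx : forall x, w x x = 0.
Notation M := (bilin w (fun=> 1) (fun=> 1)).
Variable k : R.
Hypothesis kI : #|I|%:R = k.

(** The degrees sum to M, so the squares of those at most delta M sum to at most delta M^2. *)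
Lemma rounding_bound (A : pred T) f (c0 : T -> I) (delta kappa : R) : stochastic f ->
  (forall x, A x -> forall i, f x i = dirac R c0 x i) ->
  0 <= kappa -> 0 <= delta -> 4 * delta <= kappa ^+ 2 ->
  (forall x, ~~ A x -> deg w x <= delta * M) ->
  exists c : T -> I, forall i, inside w (dirac R c) i <= inside w f i + kappa * M.
Proof.
move=> hf fA k0 d0 dk hd.
have [c hc] := rounding wC w0 wxx hf fA.
have M0 : 0 <= M by exact: bilin_ge0.
exists c => i.
have : (inside w (dirac R c) i - inside w f i) ^+ 2 <= (kappa * M) ^+ 2.
  apply: le_trans (_ : _ <= 4 * (delta * M * M)) _; last first.
    have -> : 4 * (delta * M * M) = 4 * delta * M ^+ 2 by ring.
    by rewrite exprMn ler_wpM2r ?sqr_ge0.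
  apply: le_trans (le_trans hc _).
    by rewrite (bigD1 i) //= lerDl sumr_ge0 // => j _; exact: sqr_ge0.
  rewrite ler_wpM2l // [X in _ * X]bilin11 // mulr_sumr.
  rewrite big_mkcond; apply: ler_sum => x _.
  have dx := deg_ge0 w0 x.
  case: ifP => hA; last by rewrite !mulr_ge0.
  by rewrite expr2 ler_wpM2r // hd.
have kM : 0 <= kappa * M by rewrite mulr_ge0.
rewrite -[leLHS]real_normK ?num_real // ler_sqr ?nnegrE // ler_norml; lra.
Qed.

(* [z j], the indicator of the part [j] projected orthogonally to the degrees, leaves the
   expected numbers of inside edges unchanged to first order; since the [j] below makes
   the form negative at [z j], a perturbation along it decreases all of them. *)
Lemma low_degree_surplus (c0 : T -> I) (eps kappa : R) : (1 < #|I|)%N ->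
  0 < eps -> kappa = eps / (2 * k ^+ 5) ->
  \sum_i inside w (dirac R c0) i <= M / k - eps * M ->
  (forall x, deg w x <= kappa ^+ 2 / 4 * M) ->
  exists c : T -> I, forall i, inside w (dirac R c) i <= M / k ^+ 2 - kappa * M.
Proof.
move=> I1 e0 kE sur hd.
have k2 : 2 <= k by rewrite -kI ler_nat.
have kn0 : k != 0 by rewrite gt_eqF //; lra.
have k1n0 : k - 1 != 0 by rewrite gt_eqF //; lra.
have kap0 : 0 < kappa by rewrite kE divr_gt0 // mulr_gt0 // exprn_gt0 //; lra.
have M0 : 0 <= M by exact: bilin_ge0.
have [i0 _] : exists i0 : I, i0 \in I by apply/card_gt0P; rewrite (ltn_trans _ I1).
(* The projection divides by M; if M = 0 the given colouring already satisfies the bound. *)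
have [Mz|Mpos] : M = 0 \/ 0 < M.
  by move: M0; rewrite le_eqVlt => /orP[/eqP <-|]; [left|right].
  exists c0 => i; rewrite Mz mul0r mulr0 subr0.
  have q0 j : 0 <= inside w (dirac R c0) j by apply: bilin_ge0 => // x; rewrite ler0n.
  move: sur; rewrite Mz mul0r mulr0 subr0; apply: le_trans.
  by rewrite (bigD1 i) //= lerDl sumr_ge0.
pose vol j := bilin w (fun=> 1) ((dirac R c0)^~ j).
pose al j := vol j / M.
have volE j : vol j = al j * M by rewrite /al divfK ?gt_eqF.
have sal : \sum_j al j = 1.
  rewrite -mulr_suml -bilin_sumr.
  rewrite (@eq_bilin _ _ w _ (fun=> 1) _ (fun=> 1)) ?divff ?gt_eqF // => x.
  exact: sum_delta1.
have d01 x j : 0 <= dirac R c0 x j <= 1 by rewrite ler0n lern1 leq_b1.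
have vol0 j : 0 <= vol j by apply: bilin_ge0 => // x; rewrite ler0n.
have al0 j : 0 <= al j by rewrite divr_ge0.
have al1 j : al j <= 1 by rewrite -sal (bigD1 j) //= lerDl sumr_ge0.
pose z j x := 1 * dirac R c0 x j + (- al j) * 1.
have zz j : bilin w (z j) (z j) = inside w (dirac R c0) j - al j ^+ 2 * M.
  rewrite bilin_comb // (bilinC wC ((dirac R c0)^~ j)) -/(vol j) volE -/(inside w _ j).
  ring.
have z1 j : bilin w (fun=> 1) (z j) = 0.
  by rewrite bilinDr !bilinZr -/(vol j) volE; ring.
(* Average over [j]: the squares of the volume shares sum to at least 1 / k, which cancels M / k and
   leaves the surplus. *)
have [j hj] : exists j, bilin w (z j) (z j) <= - eps * M / k.
  apply: (@weighted_mean_attained _ _ (fun=> k^-1)) => [_||].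
  - by rewrite invr_ge0; lra.
  - by rewrite sum_cst kI mulfV.
  - rewrite -mulr_sumr [leLHS]mulrC ler_wpM2r ?invr_ge0 //; first by lra.
    under eq_bigr => j _ do rewrite zz.
    rewrite sumrB -mulr_suml.
    have : 1 / k <= \sum_j al j ^+ 2.
      have : 0 <= \sum_j (al j - 1 / k) ^+ 2 by apply: sumr_ge0 => j _; exact: sqr_ge0.
      have -> : \sum_j (al j - 1 / k) ^+ 2 = \sum_j al j ^+ 2 - 1 / k.
        rewrite (eq_bigr (fun j => al j ^+ 2 - 2 / k * al j + (1 / k) ^+ 2)); last first.
          by move=> j _; ring.
        rewrite big_split sumrB -mulr_sumr sal sum_cst kI /=.
        by field.
      by rewrite subr_ge0.
    move=> h; have := ler_wpM2r M0 h; lra.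
(* Zero sum and modulus at most 1 / k keep the rows stochastic; modulus at least 1 / k^2 gives every
   part a decrease of eps M / k^5 = 2 kappa M, half of which pays for the rounding. *)
pose a (i : I) : R := if i == i0 then 1 / k else - (1 / (k * (k - 1))).
have k10 : 0 < 1 / (k * (k - 1)) by rewrite divr_gt0 // mulr_gt0; lra.
have k11 : 1 / (k * (k - 1)) <= 1 / k.
  by rewrite !div1r lef_pV2 ?posrE ?mulr_gt0 ?ler_peMr //; lra.
have k12 : 1 / k ^+ 2 <= 1 / (k * (k - 1)).
  by rewrite !div1r lef_pV2 ?posrE ?expr2 ?mulr_gt0 ?ler_pM2l //; lra.
have k13 : 0 < 1 / k ^+ 2 by rewrite divr_gt0 // exprn_gt0; lra.
have sa : \sum_i a i = 0.
  rewrite (bigD1 i0) //= /a eqxx.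
  rewrite (eq_bigr (fun=> - (1 / (k * (k - 1))))) => [|i /negPf -> //].
  rewrite sumr_const cardC1 -mulr_natl -subn1 natrB ?kI 1?ltnW //.
  by field; rewrite kn0 k1n0.
pose f x i := (1 / k) * 1 + a i * z j x.
have hz x : -1 <= z j x <= 1.
  by rewrite /z; have := d01 x j; have := al0 j; have := al1 j; lra.
have hf : stochastic f.
  split=> [x i|x]; last first.
    rewrite big_split /= -[X in _ + X]mulr_suml sa sum_cst kI.
    by field.
  have := hz x; rewrite /f /a; case: (i == i0); nra.
have qf i : inside w f i <= M / k ^+ 2 - 2 * kappa * M.
  rewrite /inside bilin_comb // z1.
  have : a i ^+ 2 >= (1 / k ^+ 2) ^+ 2.
    rewrite /a; case: (i == i0); rewrite ?sqrrN ler_sqr ?nnegrE; lra.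
  move=> h.
  have hj0 : - eps * M / k <= 0 by rewrite -mulrA mulNr oppr_le0 !mulr_ge0 ?invr_ge0; lra.
  have : a i ^+ 2 * bilin w (z j) (z j) <= (1 / k ^+ 2) ^+ 2 * (- eps * M / k) by nra.
  have -> : (1 / k ^+ 2) ^+ 2 * (- eps * M / k) = - 2 * kappa * M.
    by rewrite kE; field.
  have -> : (1 / k) ^+ 2 * M = M / k ^+ 2 by field.
  lra.
have [|||||c hc] := @rounding_bound pred0 f c0 (kappa ^+ 2 / 4) kappa hf.
- by [].
- exact: ltW.
- by rewrite divr_ge0 ?sqr_ge0.
- by rewrite mulrC divfK ?pnatr_eq0.
- by move=> x _; exact: hd.
by exists c => i; have := hc i; have := qf i; lra.
Qed.

Hypothesis w1 : forall x y, w x y <= 1.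

(** At most 1 / delta' vertices are heavy, so they span little weight, while [v] alone sends much
    weight to light vertices. All heavy vertices go to [i0], the light ones are biased away from it
    as in [balanced_bias], and only the light ones need rounding. *)
Lemma high_degree_surplus (delta gamma delta' : R) (v : T) : (1 < #|I|)%N ->
  0 < delta -> gamma = delta ^+ 2 / (16 * k ^+ 2) ->
  delta' = gamma ^+ 2 / 64 -> delta' < delta ->
  2 / (delta * delta') <= M -> 2 / (gamma * delta' ^+ 2) <= M ->
  delta * M <= deg w v ->
  exists c : T -> I, forall i, inside w (dirac R c) i <= M / k ^+ 2 - gamma / 4 * M.
Proof.
move=> I1 de0 gE dE dlt M1 M2 hv.
have k2 : 2 <= k by rewrite -kI ler_nat.
have kp : 0 < k by lra.
have kn0 : k != 0 by rewrite gt_eqF //; lra.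
have k1n0 : k - 1 != 0 by rewrite gt_eqF //; lra.
have ga0 : 0 < gamma by rewrite gE divr_gt0 // ?mulr_gt0 ?exprn_gt0 //; lra.
have d'0 : 0 < delta' by rewrite dE divr_gt0 // exprn_gt0.
have M0 : 0 < M by apply: lt_le_trans M1; rewrite divr_gt0 // mulr_gt0.
have [i0 _] : exists i0 : I, i0 \in I by apply/card_gt0P; rewrite (ltn_trans _ I1).
pose A x := delta' * M < deg w x.
have d0 x : 0 <= deg w x by exact: deg_ge0.
pose nA : R := \sum_x (A x)%:R.
have nA0 : 0 <= nA by apply: sumr_ge0 => x _; rewrite ler0n.
have cA : nA <= 1 / delta'.
  rewrite ler_pdivlMr // -(ler_pM2r M0) mul1r [leRHS]bilin11 // mulr_suml mulr_suml.
  apply: ler_sum => x _; case hA: (A x); last by rewrite !mul0r.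
  by rewrite mul1r ltW.
pose a x : R := (A x)%:R; pose l x : R := (~~ A x)%:R.
have aD x : a x + l x = 1 by rewrite /a /l; case: (A x); rewrite ?addr0 ?add0r.
have a01 x : 0 <= a x by rewrite ler0n.
have l01 x : 0 <= l x by rewrite ler0n.
pose p := bilin w a a; pose r := bilin w a l; pose s := bilin w l l.
have p0 : 0 <= p by exact: bilin_ge0.
have r0 : 0 <= r by exact: bilin_ge0.
have s0 : 0 <= s by exact: bilin_ge0.
have ME : M = p + 2 * r + s.
  have E : (fun=> 1) =1 (fun x => 1 * a x + 1 * l x) by move=> x; rewrite !mul1r aD.
  by rewrite (eq_bilin w E E) bilin_comb // -/p -/r -/s; ring.
have pA : p <= nA ^+ 2.
  rewrite expr2 mulr_suml; apply: ler_sum => x _; rewrite mulr_sumr.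
  apply: ler_sum => y _; rewrite -/(a x) -/(a y).
  by rewrite ler_piMl ?mulr_ge0.
have Av : A v by rewrite /A; apply: lt_le_trans hv; rewrite ltr_pM2r.
have rv : deg w v - nA <= r.
  have : \sum_y w v y * (a v * l y) <= r.
    rewrite /r /bilin [leRHS](bigD1 v) //= lerDl.
    by apply: sumr_ge0 => x _; apply: sumr_ge0 => y _; rewrite !mulr_ge0.
  apply: le_trans; rewrite /deg /nA -sumrB; apply: ler_sum => y _.
  rewrite {1}/a Av mul1r /l; have := w1 v y; have := w0 v y.
  by case: (A y) => /=; lra.
pose B := 2 * r / M.
have BE : 2 * r = B * M by rewrite /B divfK // gt_eqF.
(* Heavy vertices take up at most half of the degree of [v], so r >= delta M / 2 and the heavy-light
   share [B] is at least [delta]. *)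
have nA2 : nA <= delta * M / 2.
  apply: le_trans cA _; rewrite ler_pdivrMr //.
  by move: M1; rewrite ler_pdivrMr ?mulr_gt0 //; lra.
have Bd : delta <= B.
  by rewrite /B ler_pdivlMr //; lra.
have B01 : 0 <= B <= 1.
  by apply/andP; split; [lra|rewrite ler_pdivrMr //; lra].
have sB : s <= (1 - B) * M by lra.
have pg : p <= gamma / 2 * M.
  apply: le_trans pA _; apply: (@le_trans _ _ (1 / delta' ^+ 2)).
    by rewrite -[X in X / _](expr1n _ 2) -expr_div_n ler_sqr ?nnegrE // divr_ge0 // ltW.
  move: M2; rewrite !ler_pdivrMr ?mulr_gt0 ?exprn_gt0 //; lra.
have gB : gamma <= B ^+ 2 / 16 / k ^+ 2.
  rewrite gE invfM mulrA ler_wpM2r ?invr_ge0 ?sqr_ge0 // ler_wpM2r ?invr_ge0 //.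
  by rewrite ler_sqr ?nnegrE //; lra.
have [X [X0 X1 hX hY]] := balanced_bias k2 B01 gB.
pose y := (1 - X) / (k - 1).
pose b i := if i == i0 then X else y.
pose f x i := (i0 == i)%:R * a x + b i * l x.
have y0 : 0 <= y by rewrite divr_ge0 ?subr_ge0 // (le_trans _ k2) // ler1n.
have b0 i : 0 <= b i by rewrite /b; case: (i == i0).
have sb : \sum_i b i = 1.
  rewrite (bigD1 i0) //= /b eqxx (eq_bigr (fun=> y)) => [|i /negPf -> //].
  rewrite sumr_const cardC1 -mulr_natl -subn1 natrB ?kI 1?ltnW //.
  by rewrite /y; field.
have hf : stochastic f.
  split=> [x i|x]; first by rewrite addr_ge0 ?mulr_ge0 ?ler0n.
  by rewrite big_split /= -!mulr_suml sum_delta1 sb !mul1r.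
(* Of the gain [gamma], half pays for the pairs of heavy vertices and a quarter for the rounding; a
   quarter remains. *)
have qf i : inside w f i <= M / k ^+ 2 - gamma / 2 * M.
  rewrite /inside bilin_comb // -/p -/r -/s /b [i0 == i]eq_sym.
  have -> : M / k ^+ 2 = 1 / k ^+ 2 * M by rewrite mul1r mulrC.
  case: (i == i0).
    have := ler_wpM2l (sqr_ge0 X) sB.
    have := ler_wpM2r (ltW M0) hX.
    have -> : 2 * 1 * X * r = X * (2 * r) by ring.
    rewrite BE expr1n mul1r; lra.
  have := ler_wpM2l (sqr_ge0 y) sB.
  have := ler_wpM2r (ltW M0) hY; rewrite -/y.
  rewrite expr0n !mul0r !mulr0 !mul0r; lra.
have [|||||c hc] := @rounding_bound A f (fun=> i0) delta' (gamma / 4) hf.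
- by move=> x Ax i; rewrite /f /a /l Ax mulr0 addr0 mulr1.
- by rewrite divr_ge0 // ltW.
- exact: ltW.
- by rewrite dE; lra.
- by move=> x; rewrite -leNgt.
by exists c => i; have := hc i; have := qf i; lra.
Qed.
End Surplus.

(** * Merging a proper colouring *)

Section Colouring.
Variables (T : finType) (adj : rel T).
Hypothesis adjC : symmetric adj.
Hypothesis adj0 : irreflexive adj.
Local Open Scope nat_scope.

Definition arcs : {set T * T} := [set p | adj p.1 p.2].

Definition mono (J : finType) (c : T -> J) : {set T * T} :=
  [set p in arcs | c p.1 == c p.2].

(** Minimise the monochromatic arcs. If one were left, every ordered pair of distinct colours would
    carry an arc, since otherwise a freed colour could be given to [x0]. Together with the
    monochromatic arc this makes too many arcs. *)
Lemma proper_colouring (J : finType) : 0 < #|J| ->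
  #|arcs| <= #|J| * #|J|.-1 -> exists c : T -> J, mono c = set0.
Proof.
move=> /card_gt0P[j0 _] hM.
pose F (c : {ffun T -> J}) := #|mono c|.
have [c _ cmin] := @arg_minnP _ [ffun=> j0] xpredT F isT.
exists c; apply/eqP; apply: contraT => /set0Pn[[x0 y0]].
rewrite inE => /andP[]; rewrite inE /= => a0 /eqP c0.
have edge i j : i != j -> exists p, [/\ p \in arcs, c p.1 = i & c p.2 = j].
  move=> ij; suff /existsP[p /and3P[pa /eqP pi /eqP pj]] :
    [exists p, [&& p \in arcs, c p.1 == i & c p.2 == j]] by exists p.
  apply: contraT; rewrite negb_exists => /forallP noedge.
  (* with no edge between the classes [i] and [j], merging them frees the colour [j] *)
  pose c' := [ffun x => if x == x0 then j else if c x == j then i else c x].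
  suff : F c' < F c by rewrite ltnNge cmin.
  apply: proper_card; apply/properP; split.
    apply/subsetP=> [[x y]]; rewrite !inE /= !ffunE => /andP[axy].
    rewrite axy /=.
    have ni u v : adj u v -> c u = i -> c v = j -> False.
      by move=> auv /eqP ui /eqP vj; have := noedge (u, v); rewrite inE /= auv ui vj.
    have [xx|_] := eqVneq x x0; have [yx|_] := eqVneq y x0.
    - by move: axy; rewrite xx yx adj0.
    - case: (c y =P j) => [_|cy] /eqP; first by move=> jj; rewrite jj eqxx in ij.
      by move=> jj; rewrite -jj in cy.
    - case: (c x =P j) => [_|cx] /eqP; first by move=> jj; rewrite jj eqxx in ij.
      by [].
    case: (c x =P j) => [cx|cx]; case: (c y =P j) => [cy|cy] //.
    - by rewrite cx cy.
    - by move=> /eqP iy; case: (ni y x); rewrite // adjC.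
    - by move=> /eqP xi; case: (ni x y).
  exists (x0, y0); rewrite !inE /= a0 /= ?c0 ?eqxx // !ffunE eqxx.
  have -> : (y0 == x0) = false by apply/eqP=> yx; move: a0; rewrite yx adj0.
  case: (c y0 =P j) => [_|cy]; first by rewrite eq_sym.
  by apply/eqP=> jj; rewrite -jj in cy.
pose D := [set p in arcs | c p.1 != c p.2].
have cD : #|J| * #|J|.-1 <= #|D|.
  pose f p := (c p.1, c p.2).
  apply: leq_trans (leq_imset_card f _).
  have <- : #|[set q : J * J | q.1 != q.2]| = #|J| * #|J|.-1.
    rewrite -sum1dep_card -(pair_big_dep xpredT (fun i j => i != j) (fun _ _ => 1)) /=.
    rewrite (eq_bigr (fun=> #|J|.-1)) => [|i _]; first by rewrite sum_nat_const.
    by rewrite sum1dep_card -(cardC1 i); apply: eq_card => j; rewrite !inE eq_sym.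
  apply: subset_leq_card; apply/subsetP=> [[i j]]; rewrite inE /= => ij.
  have [p [pa pi pj]] := edge i j ij.
  by apply/imsetP; exists p; rewrite ?inE /f ?pi ?pj //; move: pa; rewrite inE => ->.
have : #|D| < #|arcs|.
  apply: proper_card; apply/properP; split.
    by apply/subsetP=> p; rewrite inE => /andP[].
  by exists (x0, y0); rewrite !inE //= a0 c0 eqxx.
by rewrite ltnNge (leq_trans hM cD).
Qed.

Section Merge.
Variables k q : nat.
Notation J := ('I_k * 'I_q)%type.
(** The colours form a grid of k rows of length q. A random permutation followed by the row index is
    a uniform balanced merging; this counts the permutations that merge [a] with [b]. *)
Definition together (a b : J) : nat := \sum_(s : {perm J}) ((s a).1 == (s b).1).

(** Precomposition with the transposition of [b] and [b'] leaves [a] alone. *)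
Lemma together_const a b b' : b != a -> b' != a -> together a b = together a b'.
Proof.
move=> ba b'a; rewrite /together (reindex_inj (mulgI (tperm b b'))) /=.
by apply: eq_bigr => s _; rewrite !permM tpermL tpermD.
Qed.

(** Double counting: each permutation puts exactly q - 1 other colours in the row of [a], so two
    colours merge with probability (q - 1) / (k q - 1). *)
Lemma together_sum a b : b != a ->
  (k * q).-1 * together a b = #|{perm J}| * q.-1.
Proof.
move=> ba.
have -> : (k * q).-1 * together a b = \sum_(b' | b' != a) together a b'.
  rewrite (eq_bigr (fun=> together a b)) => [|b' b'a].
    by rewrite sum_nat_const cardC1 card_prod !card_ord.
  exact: together_const.
rewrite /together exchange_big /= -sum_nat_const.
rewrite [RHS](eq_bigl xpredT) //; apply: eq_bigr => s _.
rewrite (reindex_inj (@perm_inj _ s^-1%g)) /=.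
rewrite (eq_big (fun b' => b' != s a) (fun b' => ((s a).1 == b'.1) : nat)); first last.
- by move=> b' _; rewrite permKV.
- by move=> b'; rewrite (can2_eq (permKV s) (permK s)).
case: (s a) => u v; rewrite -big_mkcondr /= sum1dep_card.
transitivity #|[set (u, j) | j in predC1 v]|; last first.
  by rewrite card_imset ?cardC1 ?card_ord // => i j [].
apply: eq_card => [[i j]]; rewrite !inE /= xpair_eqE.
apply/andP/imsetP => [[ne /eqP ui]|[j' ]].
  by exists j; rewrite ?ui // inE; move: ne; rewrite -ui eqxx.
by rewrite inE => jv [-> ->]; rewrite !eqxx jv.
Qed.

(** Every arc joins distinct colours, so [together_sum] gives the mean number of monochromatic arcs;
    some merging attains at most the mean. *)
Lemma merge_colouring (c : T -> J) : mono c = set0 ->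
  exists d : T -> 'I_k, (k * q).-1 * #|mono d| <= #|arcs| * q.-1.
Proof.
move=> c0; pose d (s : {perm J}) x := (s (c x)).1.
have S : (k * q).-1 * \sum_s #|mono (d s)| = #|{perm J}| * (#|arcs| * q.-1).
  under eq_bigr => s _.
    rewrite -sum1_card (eq_bigl (fun p => (p \in arcs) && ((s (c p.1)).1 == (s (c p.2)).1))).
      rewrite big_mkcondr /=; over.
    by move=> p; rewrite inE.
  rewrite exchange_big big_distrr /=.
  rewrite (eq_bigr (fun=> #|{perm J}| * q.-1)) => [|p pa]; last first.
    rewrite -(@together_sum (c p.1) (c p.2)).
      by congr (_ * _); apply: eq_bigr => s _; case: eqP.
    apply/negP=> /eqP cc; have : p \in mono c by rewrite inE pa cc eqxx.
    by rewrite c0 inE.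
  by rewrite sum_nat_const mulnCA.
suff /existsP[s hs] : [exists s, (k * q).-1 * #|mono (d s)| <= #|arcs| * q.-1].
  by exists (d s).
apply: contraT; rewrite negb_exists => /forallP h.
have : \sum_(s : {perm J}) (#|arcs| * q.-1) < \sum_s (k * q).-1 * #|mono (d s)|.
  rewrite (bigD1 1%g) //= [ltnRHS](bigD1 1%g) //= -addSn leq_add // ?ltnNge //.
  by apply: leq_sum => s _; rewrite ltnW // ltnNge.
by rewrite [ltnRHS](_ : _ = #|{perm J}| * (#|arcs| * q.-1)) ?sum_nat_const ?ltnn // -S big_distrr.
Qed.
End Merge.

Lemma edwards_nat k q : 0 < k -> 0 < q -> #|arcs| <= k * q * (k * q).-1 ->
  exists d : T -> 'I_k, (k * q).-1 * #|mono d| <= #|arcs| * q.-1.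
Proof.
move=> k0 q0 hM; have cJ : #|{: 'I_k * 'I_q}| = k * q by rewrite card_prod !card_ord.
have [|| c /merge_colouring //] := @proper_colouring ('I_k * 'I_q)%type.
  by rewrite cJ muln_gt0 k0.
by rewrite cJ.
Qed.

(** The least q for which k q colours suffice; the failure of q - 1 bounds k q from above. *)
Lemma minimal_block_number k : 0 < k -> 0 < #|arcs| -> exists q,
  [/\ 0 < q, #|arcs| <= k * q * (k * q).-1 & k * q.-1 * (k * q.-1).-1 < #|arcs|].
Proof.
move=> k0 M0; pose P q := #|arcs| <= k * q * (k * q).-1.
have ex : exists q, P q.
  exists #|arcs|.+1; rewrite /P; have : #|arcs|.+1 <= k * #|arcs|.+1 by rewrite leq_pmull.
  by move: (k * _) M0 => n; nia.
case: (ex_minnP ex) => q Pq qmin; exists q.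
case: q Pq qmin => [|q] Pq qmin; first by move: Pq; rewrite /P muln0 leqNgt M0.
by split=> //=; rewrite ltnNge; apply/negP=> /qmin; rewrite ltnn.
Qed.
End Colouring.

(** * The lower bound on the maximum k-cut *)

Section Edwards.
Variables (R : realFieldType) (T : finType) (adj : rel T).
Hypothesis adjC : symmetric adj.
Hypothesis adj0 : irreflexive adj.

Definition weight (x y : T) : R := (adj x y)%:R.

Lemma weight_arcs (f : T * T -> R) :
  \sum_x \sum_y weight x y * f (x, y) = \sum_(p in arcs adj) f p.
Proof.
rewrite pair_big big_mkcond [RHS]big_mkcond; apply: eq_bigr => [[x y]] _ /=.
by rewrite inE /weight /=; case: (adj x y); rewrite ?mul1r ?mul0r.
Qed.

Lemma total_weight : bilin weight (fun=> 1) (fun=> 1) = #|arcs adj|%:R.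
Proof.
rewrite /bilin (weight_arcs (fun=> 1 * 1)) mulr1 -sum1_card natr_sum.
exact: eq_bigr.
Qed.

Lemma sum_inside (J : finType) (c : T -> J) :
  \sum_j inside weight (dirac R c) j = #|mono adj c|%:R.
Proof.
rewrite /inside /bilin.
under eq_bigr => j _ do rewrite (weight_arcs (fun p => dirac R c p.1 j * dirac R c p.2 j)).
rewrite exchange_big /= -sum1_card natr_sum big_mkcond [RHS]big_mkcond.
apply: eq_bigr => p _; rewrite [p \in mono _ _]inE.
case: (p \in arcs adj) => //=.
by rewrite sum_delta /dirac [c p.2 == _]eq_sym; case: (c p.1 == c p.2).
Qed.

(** M (q - 1) / (k q - 1) = M / k - (k - 1) / k * M / (k q - 1). Minimality of q gives k q - 1 < 2 t
    + k, and M / (2 t + k) >= 2 t - (k - 1). *)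
Lemma edwards (k : nat) (t : R) : (1 < k)%N -> (0 < #|arcs adj|)%N -> 0 <= t ->
  #|arcs adj|%:R = 2 * t * (2 * t + 1) ->
  exists c : T -> 'I_k, \sum_j inside weight (dirac R c) j <=
    #|arcs adj|%:R / k%:R - 2 * (k%:R - 1) / k%:R * t + (k%:R - 1) ^+ 2 / k%:R.
Proof.
move=> k1 M0 t0 Mt; have k0 : (0 < k)%N by exact: ltnW.
have [q [q0 hq1 hq2]] := minimal_block_number k0 M0.
have [d hd] := edwards_nat adjC adj0 k0 q0 hq1.
exists d; rewrite sum_inside.
move: hd hq2; set m := #|mono adj d|; move: Mt; set M := #|arcs adj| => Mt.
rewrite -(ler_nat R) -(ltr_nat R) !natrM.
have kR : 2 <= k%:R :> R by rewrite ler_nat.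
have qR : 1 <= q%:R :> R by rewrite ler1n.
have qE : q.-1%:R = q%:R - 1 :> R by rewrite -subn1 natrB.
have nE : (k * q).-1%:R = k%:R * q%:R - 1 :> R.
  by rewrite -subn1 natrB ?muln_gt0 ?k0 // natrM.
(* For q = 1 the truncated predecessor differs from the real one, but both products vanish. *)
have nE' : k%:R * (q%:R - 1) * (k%:R * (q%:R - 1) - 1) <=
    k%:R * q.-1%:R * (k * q.-1).-1%:R :> R.
  rewrite qE; case: (posnP (k * q.-1)) => [z|p].
    move: (congr1 (fun n : nat => n%:R : R) z); rewrite natrM qE => ->.
    by rewrite !mul0r.
  by rewrite -subn1 natrB // natrM qE.
rewrite nE qE in nE' *; move: nE'.
move: (k%:R : R) (q%:R : R) (m%:R : R) (M%:R : R) Mt kR qR => {hq1 nE qE}.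
move=> kr qr mr Mr Mt kR qR h1 h2 h3.
have kp : 0 < kr by lra.
have n2t : kr * qr - 1 < 2 * t + kr.
  rewrite ltNge; apply/negP => h.
  have : (2 * t + 1) * (2 * t) <= kr * (qr - 1) * (kr * (qr - 1) - 1) by apply: ler_pM; lra.
  lra.
have n0 : 0 < kr * qr - 1 by have := ler_pM _ _ kR qR; lra.
have tk : 0 < 2 * t + kr by lra.
have M1 : 2 * t - (kr - 1) <= Mr / (kr * qr - 1).
  apply: (@le_trans _ _ (Mr / (2 * t + kr))).
    by rewrite ler_pdivlMr // Mt; nra.
  by rewrite ler_wpM2l ?lef_pV2 ?posrE // ?Mt ?mulr_ge0 //; lra.
have -> : Mr / kr - 2 * (kr - 1) / kr * t + (kr - 1) ^+ 2 / kr =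
   Mr / kr - (kr - 1) / kr * (2 * t - (kr - 1)) by field; rewrite gt_eqF.
have : mr <= Mr / kr - (kr - 1) / kr * (Mr / (kr * qr - 1)).
  have -> : Mr / kr - (kr - 1) / kr * (Mr / (kr * qr - 1)) = Mr * (qr - 1) / (kr * qr - 1).
    by field; rewrite !gt_eqF.
  by rewrite ler_pdivlMr // mulrC.
move/le_trans; apply; rewrite lerB // ler_wpM2l // divr_ge0; lra.
Qed.
End Edwards.

(** * The partition *)

(** If s >= 4 t, the quadratic term is at most s / 2, and the remaining s / 2 is at least 2 t. If s
    < 4 t, then s^2 <= 4 M and the quadratic term is at most 36 k beta, while the lower bound on s
    supplies the main term. *)
Lemma quadratic_cost (R : realFieldType) (k beta t M s : R) : 2 <= k -> 0 <= beta ->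
  0 <= t -> 0 < M -> 4 * t ^+ 2 <= M -> 0 <= s ->
  s <= M / (18 * k * (beta + 1)) ->
  2 * (k - 1) / k * t - (k - 1) ^+ 2 / k <= s ->
  - s + beta / M * (k * (9 * s ^+ 2)) <=
  - (2 * (k - 1) / k * t) + ((k - 1) ^+ 2 / k + 36 * k * beta).
Proof.
move=> k2 b0 t0 M0 tM s0 sM sk.
have kp : 0 < k by lra.
have kt : 2 * (k - 1) / k * t <= 2 * t.
  by rewrite ler_wpM2r // ler_pdivrMr //; lra.
have kk : 0 <= (k - 1) ^+ 2 / k by rewrite divr_ge0 ?sqr_ge0 // ltW.
have kb : 0 <= k * beta by rewrite mulr_ge0 // ltW.
have E : beta / M * (k * (9 * s ^+ 2)) = 9 * (k * beta) * (s ^+ 2 / M).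
  by field; rewrite gt_eqF.
rewrite E; have [st|st] := lerP (4 * t) s.
  have : 9 * (k * beta) * (s ^+ 2 / M) <= s / 2.
    rewrite mulrA ler_pdivrMr // expr2 mulrA.
    have -> : s / 2 * M = s * (M / 2) by ring.
    rewrite mulrC ler_wpM2l //.
    move: sM; rewrite ler_pdivlMr; last by rewrite !mulr_gt0; lra.
    have := mulr_ge0 (ltW kp) s0; lra.
  lra.
have : s ^+ 2 / M <= 4.
  rewrite ler_pdivrMr //; apply: (@le_trans _ _ ((4 * t) ^+ 2)); last by lra.
  by rewrite ler_sqr ?nnegrE //; lra.
move=> /(ler_wpM2l kb); lra.
Qed.

Section Partition.
Variables (R : realFieldType) (k : nat).
Hypothesis k2 : (2 <= k)%N.
Notation K := (k%:R : R).

(* [arcs] are ordered pairs: [M] is twice the number of edges, and [t] is [tfun (M / 2)]. *)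
Lemma partition_dichotomy (beta L : R) : 0 <= beta -> 0 <= L ->
  exists C : R, forall (T : finType) (adj : rel T) (t : R),
    symmetric adj -> irreflexive adj -> 0 <= t -> (0 < #|arcs adj|)%N ->
    let M : R := #|arcs adj|%:R in M = 2 * t * (2 * t + 1) ->
    exists c : T -> 'I_k, let q i := inside (weight R adj) (dirac R c) i in
      \sum_i (q i - M / K ^+ 2) + beta / M * \sum_i (q i - M / K ^+ 2) ^+ 2
        <= - (2 * (K - 1) / K * t) + C
      \/ forall i, q i <= M / K ^+ 2 - L * t.
Proof.
move=> b0 L0.
have kI : #|'I_k|%:R = K by rewrite card_ord.
have sumK (a : R) : \sum_(i < k) a = K * a by rewrite sum_cst kI.
have KR : 2 <= K by rewrite ler_nat.
have kI1 : (1 < #|'I_k|)%N by rewrite card_ord.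
have kp : 0 < K by lra.
have Mmono (s u : R) : 0 <= s -> s <= u -> 2 * s * (2 * s + 1) <= 2 * u * (2 * u + 1).
  by move=> s0 su; apply: ler_pM; lra.
(* [eps * M] is the surplus up to which [quadratic_cost] applies. Beyond it, [kap] and [gam / 4] are
   the gains for low and high degrees, separated at [del * M]. *)
pose eps : R := 1 / (18 * K * (beta + 1)).
pose kap := eps / (2 * K ^+ 5).
pose del := kap ^+ 2 / 4.
pose gam := del ^+ 2 / (16 * K ^+ 2).
pose del' := gam ^+ 2 / 64.
have e0 : 0 < eps by rewrite divr_gt0 // !mulr_gt0 //; lra.
have kap0 : 0 < kap by rewrite divr_gt0 // mulr_gt0 // exprn_gt0.
have del0 : 0 < del by rewrite divr_gt0 // exprn_gt0.
have gam0 : 0 < gam by rewrite divr_gt0 ?exprn_gt0 // mulr_gt0 ?exprn_gt0.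
have del'0 : 0 < del' by rewrite divr_gt0 ?exprn_gt0.
have e1 : eps <= 1.
  rewrite /eps ler_pdivrMr ?mulr_gt0 //; last by lra.
  have := mulr_ge0 (ltW kp) b0; lra.
have Kn m : 1 <= K ^+ m by rewrite exprn_ege1 //; lra.
have kap1 : kap <= 1.
  by rewrite /kap ler_pdivrMr ?mulr_gt0 ?exprn_gt0 //; have := Kn 5%N; lra.
have del1 : del <= 1.
  by rewrite /del; have := @exprn_ile1 _ 2 _ (ltW kap0) kap1; lra.
have gamdel : gam <= del.
  rewrite /gam ler_pdivrMr ?mulr_gt0 ?exprn_gt0 //.
  rewrite expr2; apply: ler_wpM2l; first exact: ltW.
  by have := Kn 2%N; lra.
have del'del : del' < del.
  rewrite /del' ltr_pdivrMr // expr2.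
  have := ler_pM (ltW gam0) (ltW gam0) gamdel (le_trans gamdel del1); lra.
(* Both factors are at most 1, so their product is a gain valid in both cases. *)
pose mu := kap * (gam / 4).
have mu0 : 0 < mu by rewrite mulr_gt0 // divr_gt0.
have gam1 : gam / 4 <= 1 by lra.
have mukap : mu <= kap by rewrite ler_piMr // ltW.
have mugam : mu <= gam / 4 by rewrite ler_piMl // divr_ge0 // ltW.
(* From [t1] on, M >= t meets the size conditions of [high_degree_surplus], and mu M covers L t. *)
pose t1 := 1 + L / mu + 2 / (del * del') + 2 / (gam * del' ^+ 2).
have h1 : 0 <= L / mu by rewrite divr_ge0 // ltW.
have h2 : 0 <= 2 / (del * del') by rewrite divr_ge0 // mulr_ge0 // ltW.
have h3 : 0 <= 2 / (gam * del' ^+ 2) by rewrite divr_ge0 // mulr_ge0 ?exprn_ge0 // ltW.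
pose C0 := K * (1 + beta) * (2 * t1 * (2 * t1 + 1)) + 2 * t1.
have t10 : 0 <= t1 by rewrite /t1; lra.
have C00 : 0 <= C0.
  have p1 : 0 <= 2 * t1 by rewrite mulr_ge0.
  have p2 : 0 <= 1 + beta by rewrite addr_ge0.
  by rewrite /C0 addr_ge0 // mulr_ge0 // mulr_ge0 ?addr_ge0 // ltW.
exists ((K - 1) ^+ 2 / K + 36 * K * beta + C0) => T adj t adjC adj0 t0 M0 M Mt.
set w := weight R adj.
have wC x y : w x y = w y x by rewrite /w /weight adjC.
have w0 x y : 0 <= w x y by rewrite ler0n.
have w1 x y : w x y <= 1 by rewrite lern1 leq_b1.
have wxx x : w x x = 0 by rewrite /w /weight adj0.
have MW : bilin w (fun=> 1) (fun=> 1) = M by exact: total_weight.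
have Mpos : 0 < M by rewrite ltr0n.
have i0 : 'I_k by apply: (@Ordinal _ 0%N); exact: ltn_trans k2.
have C1 : 0 <= (K - 1) ^+ 2 / K + 36 * K * beta.
  by rewrite addr_ge0 ?divr_ge0 ?sqr_ge0 ?mulr_ge0 // ltW.
have kt : 2 * (K - 1) / K * t <= 2 * t.
  by rewrite ler_wpM2r // ler_pdivrMr //; lra.
have sumE (c : T -> 'I_k) : \sum_i (inside w (dirac R c) i - M / K ^+ 2) =
    - (M / K - \sum_i inside w (dirac R c) i).
  rewrite sumrB sumK opprB; congr (_ - _).
  by field; rewrite gt_eqF.
(* Below [t1] the number of edges is bounded: a single part may hold everything, at a cost absorbed
   by [C0]. *)
have [tt|tt] := ltrP t t1.
  exists (fun=> i0) => q; left.
  have q0 i : 0 <= q i by apply: bilin_ge0 => // x; rewrite ler0n.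
  have qM i : q i <= M.
    apply: (@le_trans _ _ (\sum_j q j)); first by rewrite (bigD1 i) //= lerDl sumr_ge0.
    rewrite sum_inside ler_nat; apply: subset_leq_card; apply/subsetP => p.
    by rewrite inE => /andP[].
  have a0 : 0 <= M / K ^+ 2 by rewrite divr_ge0 ?sqr_ge0 ?ltW.
  have a1 : M / K ^+ 2 <= M.
    by rewrite ler_pdivrMr ?exprn_gt0 // ler_peMr // ltW.
  have S1 : \sum_i (q i - M / K ^+ 2) <= K * M.
    rewrite -sumK; apply: ler_sum => i _; have := qM i; lra.
  have S2 : \sum_i (q i - M / K ^+ 2) ^+ 2 <= K * M ^+ 2.
    rewrite -sumK; apply: ler_sum => i _.
    rewrite -real_normK ?num_real // ler_sqr ?nnegrE ?(ltW Mpos) // ler_norml.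
    by have := qM i; have := q0 i; lra.
  have := ler_wpM2l (divr_ge0 b0 (ltW Mpos)) S2.
  have -> : beta / M * (K * M ^+ 2) = K * beta * M by field; rewrite gt_eqF.
  have : K * (1 + beta) * M <= K * (1 + beta) * (2 * t1 * (2 * t1 + 1)).
    rewrite ler_wpM2l ?mulr_ge0 ?addr_ge0 ?(ltW kp) // Mt.
    by apply: Mmono => //; exact: ltW.
  rewrite /C0; lra.
have Mt4 : 4 * t ^+ 2 <= M by rewrite Mt expr2; nra.
have tM : t <= M.
  apply: le_trans Mt4; have : 1 * t <= t * t by apply: ler_wpM2r => //; rewrite /t1 in tt; lra.
  by rewrite -expr2; lra.
have LtM : L * t <= mu * M.
  have : L <= mu * t by rewrite mulrC -ler_pdivrMr //; rewrite /t1 in tt; lra.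
  move=> /(ler_wpM2r t0); rewrite -mulrA -expr2 => /le_trans; apply.
  by rewrite ler_wpM2l ?(ltW mu0) //; have := sqr_ge0 t; lra.
have [c1 hc1] := min_colouring w (fun=> i0).
have dev : forall i, `|inside w (dirac R c1) i - M / K ^+ 2|
     <= 3 * (M / K - \sum_i inside w (dirac R c1) i).
  have := inside_deviation wC kI (ltnW kI1) (inside_le_between wC wxx hc1).
  by rewrite MW.
have [c2 hc2] := edwards adjC adj0 k2 M0 t0 Mt.
have := hc1 c2; move: hc2; rewrite -/w -/M => hc2 hc12.
set s := M / K - _ in dev.
have s0 : 0 <= s by have := le_trans (normr_ge0 _) (dev i0); lra.
have [sE|sE] := lerP s (eps * M).
  exists c1 => q; left; rewrite sumE -/s.
  have S2 : \sum_i (q i - M / K ^+ 2) ^+ 2 <= K * (9 * s ^+ 2).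
    rewrite -sumK; apply: ler_sum => i _.
    have -> : 9 * s ^+ 2 = (3 * s) ^+ 2 by ring.
    by rewrite -real_normK ?num_real // ler_sqr ?nnegrE ?mulr_ge0.
  have := ler_wpM2l (divr_ge0 b0 (ltW Mpos)) S2.
  have : - s + beta / M * (K * (9 * s ^+ 2)) <=
    - (2 * (K - 1) / K * t) + ((K - 1) ^+ 2 / K + 36 * K * beta).
    apply: quadratic_cost => //; first by move: sE; rewrite /eps; lra.
    by rewrite /s; lra.
  lra.
suff [c hc] : exists c : T -> 'I_k, forall i, inside w (dirac R c) i <= M / K ^+ 2 - mu * M.
  by exists c => q; right => i; have := hc i; rewrite -/(q i); lra.
have [/forallP hd|] := boolP [forall v, deg w v <= del * M].
  have [||| c hc] := @low_degree_surplus _ _ _ w wC w0 wxx K kI c1 eps kap kI1 e0.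
  - by [].
  - by rewrite MW; move: sE; rewrite /s; lra.
  - by move=> x; rewrite MW; exact: hd.
  exists c => i; have := hc i; rewrite MW => /le_trans; apply.
  by rewrite lerB // ler_wpM2r // ltW.
rewrite negb_forall => /existsP[v]; rewrite -ltNge => /ltW hv.
have [|||||| c hc] := @high_degree_surplus _ _ _ w wC w0 wxx K kI w1 del gam del' v kI1 del0.
- by [].
- by [].
- by [].
- by rewrite MW; apply: le_trans tM; apply: le_trans tt; rewrite /t1; lra.
- by rewrite MW; apply: le_trans tM; apply: le_trans tt; rewrite /t1; lra.
- by rewrite MW.
exists c => i; have := hc i; rewrite MW => /le_trans; apply.
by rewrite lerB // ler_wpM2r // ltW.
Qed.
End Partition.

(** * Edges and ordered adjacent pairs *)

Section EdgesArcs.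
Variables (T : finType) (adj : rel T).
Hypothesis adjC : symmetric adj.
Hypothesis adj0 : irreflexive adj.

(** The fibres of (x, y) -> {x, y} over the edges have exactly two elements, by symmetry and
    irreflexivity. *)
Lemma arcs_in (S : {set T}) :
  #|[set p in arcs adj | (p.1 \in S) && (p.2 \in S)]| = (2 * edges_in adj S)%N.
Proof.
set D := [set p in _ | _]; pose f (p : T * T) := [set p.1; p.2].
have -> : edges_in adj S = #|f @: D|.
  apply: eq_card => A; rewrite inE; apply/existsP/imsetP => [[x /existsP[y]]|[[x y]]].
    case/and4P=> /eqP -> axy xS yS; exists (x, y) => //.
    by rewrite !inE /= axy xS.
  rewrite !inE /= => /andP[axy /andP[xS yS]] ->.
  by exists x; apply/existsP; exists y; rewrite axy xS yS eqxx.
rewrite -sum1_card (partition_big_imset f) /= mulnC -sum_nat_const.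
apply: eq_bigr => _ /imsetP[[a b] abD ->].
have ab : a != b by apply: contraTneq abD => ->; rewrite !inE /= adj0.
rewrite sum1dep_card -(_ : #|[set (a, b); (b, a)]| = 2%N); last first.
  by rewrite cards2 xpair_eqE negb_and ab.
apply: eq_card => [[x y]]; rewrite !inE /= !xpair_eqE.
apply/andP/orP => [[/and3P[axy _ _] /eqP E]|].
  have : x \in f (x, y) by rewrite !inE eqxx.
  have : y \in f (x, y) by rewrite !inE eqxx orbT.
  rewrite E !inE /=.
  have xy : x != y by apply: contraTneq axy => ->; rewrite adj0.
  case/orP=> /eqP yE /orP[] /eqP xE; subst; rewrite ?eqxx //; by [left|right|rewrite eqxx in xy].
move: abD; rewrite !inE /= => /and3P[aab aS bS].
case=> /andP[/eqP-> /eqP->]; rewrite ?aab ?[adj b a]adjC ?aab ?aS ?bS //.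
by rewrite /f setUC.
Qed.

Lemma card_arcs : #|arcs adj| = (2 * nedges adj)%N.
Proof. by rewrite /nedges -arcs_in; apply: eq_card => p; rewrite !inE !andbT. Qed.

Lemma inside_edges (R : realFieldType) (I : finType) (c : T -> I) (i : I) :
  inside (weight R adj) (dirac R c) i = 2 * (edges_in adj [set x | c x == i])%:R.
Proof.
rewrite -natrM -arcs_in /inside /bilin.
rewrite (weight_arcs adj (fun p => dirac R c p.1 i * dirac R c p.2 i)).
rewrite -sum1_card natr_sum big_mkcond [RHS]big_mkcond; apply: eq_bigr => p _.
rewrite [p \in [set _ in _ | _]]inE !inE /dirac.
by case: (adj p.1 p.2); case: (c p.1 == i); case: (c p.2 == i); rewrite /= ?mulr1 ?mulr0.
Qed.
End EdgesArcs.

(** * From the dichotomy to sums of powers *)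

Lemma power_sum_bound (k : nat) (lam : R) : (2 <= k)%N -> 1 <= lam ->
  exists C : R, forall (T : finType) (adj : rel T), simple_graph adj ->
    (1 <= nedges adj)%N -> exists part : T -> 'I_k,
      let m : R := (nedges adj)%:R in
      \sum_(i < k) powR (edges_in adj [set x | part x == i])%:R lam <=
      powR (m / k%:R ^+ 2) (lam - 1) *
        (m / k%:R - (k%:R - 1) * lam / k%:R * tfun m + C).
Proof.
move=> k2 l1; have K2 : 2 <= k%:R :> R by rewrite ler_nat.
have K1 : 1 <= k%:R :> R by lra.
have [beta [/RleP b0 Hb]] := powR_taylor _ _ (elimT RleP l1) (elimT RleP K1).
have taylor (m x : R) : 0 < m -> 0 <= x -> x <= m -> let a := m / k%:R ^+ 2 in
    powR x lam <= powR a (lam - 1) * (a + lam * (x - a) + beta / m * (x - a) ^+ 2).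
  move=> /RltP m0 /RleP x0 /RleP xm; have := Hb m x m0 (conj x0 xm).
  by cbv zeta => /RleP; rewrite !(RpowE, RdivE, RmultE, RplusE, RminusE).
have below (a x : R) : 0 < a -> 0 <= x -> x <= a -> powR x lam <= powR a (lam - 1) * x.
  move=> /RltP a0 /RleP x0 /RleP xa; apply/RleP.
  exact: powR_below (elimT RleP l1) a0 (conj x0 xa).
have bl0 : 0 <= beta / lam by rewrite divr_ge0 //; lra.
have ll0 : 0 <= 2 * lam by lra.
(* The dichotomy concerns doubled edge counts. With [beta / lam], its first alternative times lam /
   2 is the sum of the Taylor bounds; with [2 * lam], the second reads e_i <= a - lam t. *)
have [C HC] := partition_dichotomy k2 bl0 ll0.
(* The absolute value makes the constant nonnegative, as the second alternative requires. *)
exists (lam * `|C|) => T adj [adjC adj0] m1.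
set n := nedges adj in m1 *; set m : R := n%:R.
have m0 : 0 < m by rewrite ltr0n.
have t0 : 0 <= tfun m by apply/RleP/tfun_ge0/RleP/ltW.
have tE : m = tfun m * (2 * tfun m + 1) by apply: tfun_eq; apply/RleP/ltW.
have ar0 : (0 < #|arcs adj|)%N by rewrite card_arcs // muln_gt0.
have arE : #|arcs adj|%:R = 2 * m by rewrite card_arcs // natrM.
have [|c hc] := HC T adj (tfun m) adjC adj0 t0 ar0; first by rewrite arE {1}tE mulrA.
exists c => /=; rewrite -/m.
pose e i : R := (edges_in adj [set x | c x == i])%:R.
have qE i : inside (weight R adj) (dirac R c) i = 2 * e i by exact: inside_edges.
set K : R := k%:R in K2 K1 *; set a := m / K ^+ 2; set t := tfun m.
have kp : 0 < K by lra.
have a0 : 0 < a by rewrite divr_gt0 // exprn_gt0.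
have e0 i : 0 <= e i by rewrite ler0n.
have em i : e i <= m.
  have : 2 * e i <= 2 * m.
    rewrite -qE -arE; apply: (@le_trans _ _ (\sum_j inside (weight R adj) (dirac R c) j)).
      by rewrite (bigD1 i) //= lerDl sumr_ge0 // => j _; rewrite qE mulr_ge0.
    rewrite sum_inside ler_nat; apply: subset_leq_card; apply/subsetP => p.
    by rewrite inE => /andP[].
  by rewrite ler_pM2l.
have P0 : 0 <= powR a (lam - 1) by apply/RleP/powR_ge0.
have aK : m / K = K * a by rewrite /a; field; rewrite gt_eqF.
have sumK (x : R) : \sum_(i < k) x = K * x by rewrite sumr_const card_ord mulr_natl.
have Ct : 0 <= (K - 1) / K * t by rewrite mulr_ge0 // divr_ge0 //; lra.
have Ct1 : (K - 1) / K * t <= t by rewrite ler_piMl // ler_pdivrMr //; lra.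
have El : (K - 1) * lam / K * t = lam * ((K - 1) / K * t) by ring.
have lC : C <= `|C| by exact: ler_norm.
have aE : #|arcs adj|%:R / K ^+ 2 = 2 * a by rewrite arE /a mulrA.
rewrite El aK; case: hc => [hc|hc].
  have := hc; rewrite -/K aE arE -/t.
  have -> : \sum_i (inside (weight R adj) (dirac R c) i - 2 * a) = 2 * \sum_i (e i - a).
    by rewrite mulr_sumr; apply: eq_bigr => i _; rewrite qE mulrBr.
  have -> : \sum_i (inside (weight R adj) (dirac R c) i - 2 * a) ^+ 2 =
      2 ^+ 2 * \sum_i (e i - a) ^+ 2.
    by rewrite mulr_sumr; apply: eq_bigr => i _; rewrite qE -mulrBr exprMn.
  move=> {}hc.
  apply: (@le_trans _ _ (\sum_i powR a (lam - 1) *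
     (a + lam * (e i - a) + beta / m * (e i - a) ^+ 2))).
    by apply: ler_sum => i _; exact: taylor _ _ m0 (e0 i) (em i).
  rewrite -mulr_sumr ler_wpM2l // !big_split /= sumK -!mulr_sumr.
  rewrite -addrA -addrA lerD2l.
  have := ler_wpM2l (_ : 0 <= lam / 2) hc.
  set S1 := \sum_i _; set S2 := \sum_i _.
  have -> : lam / 2 * (2 * S1 + beta / lam / (2 * m) * (2 ^+ 2 * S2)) =
      lam * S1 + beta / m * S2 by field; rewrite !gt_eqF //; lra.
  move=> /(_ _)/le_trans; apply; first lra.
  have -> : lam / 2 * (- (2 * (K - 1) / K * t) + C) =
    - (lam * ((K - 1) / K * t)) + lam * (C / 2) by field; rewrite gt_eqF.
  rewrite lerD2l ler_wpM2l //; first lra.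
  by have := normr_ge0 C; lra.
apply: (@le_trans _ _ (\sum_(i < k) powR a (lam - 1) * (a - lam * t))).
  apply: ler_sum => i _.
  have ei : e i <= a - lam * t.
    have := hc i; rewrite qE -/K aE -/t; lra.
  have lt0 : 0 <= lam * t by rewrite mulr_ge0 //; lra.
  apply: (@le_trans _ _ (powR a (lam - 1) * e i)); last by rewrite ler_wpM2l.
  by apply: below => //; lra.
rewrite -mulr_sumr ler_wpM2l // sumK.
have : lam * ((K - 1) / K * t) <= lam * t by rewrite ler_wpM2l //; lra.
have : 0 <= lam * `|C| by rewrite mulr_ge0 //; lra.
have : lam * t <= K * (lam * t) by rewrite ler_peMl // mulr_ge0 //; lra.
lra.
Qed.

Local Close Scope ring_scope.
Delimit Scope R_scope with R.

Theorem theorem4p3 (k : nat) (hk : (3 <= k)%N) (lam : R) (hlam : (1 <= lam)%R) :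
  exists C : R,
    forall (T : finType) (adj : rel T), simple_graph adj ->
      (1 <= nedges adj)%N ->
      exists part : T -> 'I_k,
        let m := INR (nedges adj) in
        (\big[Rplus/0%R]_(i < k)
            powR (INR (edges_in adj [set x | part x == i])) lam
         <= powR m lam / powR (INR k) (2 * lam - 1)
            - (INR k - 1) * lam / powR (INR k) (2 * lam - 1)
                * powR m (lam - 1) * tfun m
            + C * powR m (lam - 1))%R.
Proof.
have [C HC] := power_sum_bound (ltnW hk) (introT RleP hlam).
exists (Rdiv C (powR (INR k) (2 * lam - 2)))%R => T adj sg m1.
have [part hp] := HC T adj sg m1.
have k0 : (0 < INR k)%R by apply: lt_0_INR; apply/ssrnat.ltP; apply: leq_trans hk.
exists part => m.
have m0 : (0 < m)%R by apply: lt_0_INR; apply/ssrnat.ltP.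
rewrite powR_normalise //; apply/RleP.
rewrite !(RpowE, RdivE, RmultE, RplusE, RminusE) /m !INRE.
under eq_bigr => i _ do rewrite INRE.
exact: hp.
Qed.
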